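(* Let $\mathcal A$ be a commutative Fréchet algebra which is a BSE-algebra, whose underlying Fréchet space is a Schwartz space, and whose carrier space $\Delta(\mathcal A)$ is discrete. Let $I$ be an essential closed ideal of $\mathcal A$. Then: (i) $C_{\mathrm{BSE}}(\Delta(I))\subseteq\widehat{\mathrm M(I)}$; (ii) $\widehat{\mathrm M\left(\frac{\mathcal A}{I}\right)}=C_{\mathrm{BSE}}\left(\Delta\left(\frac{\mathcal A}{I}\right)\right)$.
   Context: A Fréchet algebra is a complete metrizable (Hausdorff) topological algebra over $\mathbb C$ whose topology is generated by a countable increasing family of submultiplicative seminorms $(p_\ell)_{\ell\in\mathbb N}$. A Fréchet space is Schwartz if for every continuous seminorm $p$ there is a continuous seminorm $q\ge p$ such that $\{x:q(x)\le1\}$ is precompact with respect to $p$. For a commutative Fréchet algebra $\mathcal C$, $\mathcal C^*$ is its topological dual, and the carrier space $\Delta(\mathcal C)\subseteq\mathcal C^*$ is the set of all nonzero continuous multiplicative linear functionals $\mathcal C\to\mathbb C$, with the Gelfand topology (topology of pointwise convergence on $\mathcal C$). BSE-functions: for a bounded set $M\subseteq\mathcal C$ and $f\in\mathcal C^*$, put $P_M(f)=\sup_{a\in M}|f(a)|$. A bounded continuous function $\sigma:\Delta(\mathcal C)\to\mathbb C$ is a BSE-function if there exist a bounded set $M\subseteq\mathcal C$ and a real number $\beta_M>0$ such that for all $n$, all $c_1,\dots,c_n\in\mathbb C$ and all $\varphi_1,\dots,\varphi_n\in\Delta(\mathcal C)$, $\left|\sum_{i=1}^n c_i\sigma(\varphi_i)\right|\le\beta_M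 P_M\left(\sum_{i=1}^n c_i\varphi_i\right)$. The set of all BSE-functions is $C_{\mathrm{BSE}}(\Delta(\mathcal C))$. Multipliers: a linear operator $T:\mathcal C\to\mathcal C$ is a multiplier if $aT(b)=T(ab)$ for all $a,b\in\mathcal C$; $\mathrm M(\mathcal C)$ is the set of all multipliers. For $T\in\mathrm M(\mathcal C)$ there is a unique continuous function $\widehat T$ on $\Delta(\mathcal C)$ with $\varphi(T(a))=\widehat T(\varphi)\varphi(a)$ for all $a\in\mathcal C$, $\varphi\in\Delta(\mathcal C)$. Put $\widehat{\mathrm M(\mathcal C)}=\{\widehat T:T\in\mathrm M(\mathcal C)\}$. $\mathcal C$ is a BSE-algebra if $\widehat{\mathrm M(\mathcal C)}=C_{\mathrm{BSE}}(\Delta(\mathcal C))$. A closed ideal $I$ of $\mathcal A$ is a Fréchet algebra with the seminorms $p_\ell|_I$, and $\mathcal A/I$ is a Fréchet algebra with the seminorms $s_\ell(x+I)=\inf\{p_\ell(x+y):y\in I\}$. The ideal $I$ is essential if $I$ equals the closed linear span of $\{ax:a\in\mathcal A,\ x\in I\}$. *)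

(* Defs.v *)
From HB Require Import structures.
From mathcomp Require Import all_boot all_order all_algebra.
From mathcomp Require Import generic_quotient ring_quotient complex.
From mathcomp Require Import boolp classical_sets functions reals.
From mathcomp Require Import topology normedtype.

Set Implicit Arguments.
Unset Strict Implicit.
Unset Printing Implicit Defensive.

Import Order.TTheory GRing.Theory Num.Theory.
Import numFieldNormedType.Exports.

Local Open Scope classical_set_scope.
Local Open Scope ring_scope.
Local Open Scope complex_scope.
Local Open Scope quotient_scope.

(* Real-valued modulus on [R[i]]; the library norm [`|z|] is [R[i]]-valued. *)
Notation cabs := Normc.normc.

(* Commutative complex algebras, in general without unit, whose uniform
   structure is generated by an increasing sequence of submultiplicative
   seminorms.  Neither the Hausdorff property nor completeness is included. *)
HB.mixin Record Uniform_isComLmcAlg (R : realType) E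
    & Uniform E & GRing.Lmodule R[i] E := {
  amul : E -> E -> E;
  snorm : nat -> E -> R;
  amulA : associative amul;
  amulC : commutative amul;
  amulDl : forall a b c : E, amul (a + b) c = amul a c + amul b c;
  amulZl : forall (k : R[i]) (a b : E), amul (k *: a) b = k *: amul a b;
  snormD : forall l (a b : E), snorm l (a + b) <= snorm l a + snorm l b;
  snormZ : forall l (k : R[i]) (a : E), snorm l (k *: a) = cabs k * snorm l a;
  snormM : forall l (a b : E), snorm l (amul a b) <= snorm l a * snorm l b;
  snorm_le : forall l (a : E), snorm l a <= snorm l.+1 a;
  entourage_snorm : entourage = [set U : set (E * E) | exists l e,
    0 < e /\ forall a b, snorm l (a - b) < e -> U (a, b)]
}.

#[short(type="comLmcAlgType")]
HB.structure Definition ComLmcAlg (R : realType) :=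
  {E of Uniform_isComLmcAlg R E & Uniform E & GRing.Lmodule R[i] E}.

HB.factory Record Lmodule_isComLmcAlg (R : realType) E
    & GRing.Lmodule R[i] E := {
  amul : E -> E -> E;
  snorm : nat -> E -> R;
  amulA : associative amul;
  amulC : commutative amul;
  amulDl : forall a b c : E, amul (a + b) c = amul a c + amul b c;
  amulZl : forall (k : R[i]) (a b : E), amul (k *: a) b = k *: amul a b;
  snormD : forall l (a b : E), snorm l (a + b) <= snorm l a + snorm l b;
  snormZ : forall l (k : R[i]) (a : E), snorm l (k *: a) = cabs k * snorm l a;
  snormM : forall l (a b : E), snorm l (amul a b) <= snorm l a * snorm l b;
  snorm_le : forall l (a : E), snorm l a <= snorm l.+1 a
}.

HB.builders Context R E & Lmodule_isComLmcAlg R E.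

Let ent : set (set (E * E)) := [set U : set (E * E) | exists l e,
    0 < e /\ forall a b, snorm l (a - b) < e -> U (a, b)].

Let snorm_leq l m a : (l <= m)%N -> snorm l a <= snorm m a.
Proof.
move=> /subnK <-; elim: (m - l)%N => [//|k IH].
by rewrite addSn (le_trans IH)// snorm_le.
Qed.

Let snorm0 l : snorm l 0 = 0.
Proof. by rewrite -[0 in LHS](scale0r 0) snormZ Normc.normc0 mul0r. Qed.

Let snormN l a : snorm l (- a) = snorm l a.
Proof. by rewrite -scaleN1r snormZ normcN Normc.normc1 mul1r. Qed.

Let ent_filter : Filter ent.
Proof.
split.
- by exists 0%N, 1; split.
- move=> P Q [l [e [e0 HP]]] [m [d [d0 HQ]]].
  exists (maxn l m), (Num.min e d); split; first by rewrite lt_min e0.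
  move=> a b; rewrite lt_min => /andP[h1 h2]; split.
    by apply/HP/(le_lt_trans _ h1); rewrite snorm_leq// leq_maxl.
  by apply/HQ/(le_lt_trans _ h2); rewrite snorm_leq// leq_maxr.
- move=> P Q PQ [l [e [e0 HP]]]; exists l, e; split=> // a b h.
  exact/PQ/HP.
Qed.

Let ent_diag A : ent A -> (diagonal `<=` A)%classic.
Proof.
move=> [l [e [e0 HA]]] [a b] /diagonalP <-.
by apply: HA; rewrite subrr snorm0.
Qed.

Let ent_inv A : ent A -> ent (A^-1)%relation.
Proof.
move=> [l [e [e0 HA]]]; exists l, e; split=> // a b h.
by apply: HA; rewrite -opprB snormN.
Qed.

Let ent_split A : ent A -> exists2 B, ent B & (B \; B `<=` A)%relation.
Proof.
move=> [l [e [e0 HA]]].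
exists [set u | snorm l (u.1 - u.2) < e / 2].
  by exists l, (e / 2); split; first exact: divr_gt0.
move=> [a b] [c /= h1 h2]; apply: HA.
rewrite -(subrKA c) (splitr e).
by rewrite (le_lt_trans (snormD _ _ _))// ltrD.
Qed.

HB.instance Definition _ :=
  isUniform.Build E ent_filter ent_diag ent_inv ent_split.
HB.instance Definition _ := Uniform_isComLmcAlg.Build R E
  amulA amulC amulDl amulZl snormD snormZ snormM snorm_le erefl.

HB.end.

HB.mixin Record ComLmcAlg_isFrechet (R : realType) E & ComLmcAlg R E := {
  frechet_hausdorff : hausdorff_space E;
  frechet_complete : forall F : set_system E,
    ProperFilter F -> cauchy F -> exists x : E, F --> x
}.

#[short(type="comFrechetAlgType")]
HB.structure Definition ComFrechetAlg (R : realType) :=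
  {E of ComLmcAlg R E & ComLmcAlg_isFrechet R E}.

Section Ideals.
Context {R : realType} (A : comLmcAlgType R).

Record ideal := Ideal {
  ideal_set :> set A;
  ideal0 : ideal_set 0;
  idealD : forall x y, ideal_set x -> ideal_set y -> ideal_set (x + y);
  idealZ : forall (k : R[i]) x, ideal_set x -> ideal_set (k *: x);
  idealM : forall a x, ideal_set x -> ideal_set (amul a x)
}.

Definition lin_span (S : set A) : set A := [set y | exists n,
  exists c : 'I_n -> R[i], exists2 x : 'I_n -> A,
    forall i, S (x i) & y = \sum_(i < n) c i *: x i].

Definition essential (I : ideal) : Prop :=
  (I : set A) = closure (lin_span
    [set y | exists a, exists2 x, ideal_set I x & y = amul a x]).

Definition ideal_mem (I : ideal) : {pred A} := [pred x | x \in (I : set A)].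

End Ideals.

Section SnormTheory.
Context {R : realType} {A : comLmcAlgType R}.

Lemma snorm0 l : snorm l (0 : A) = 0.
Proof. by rewrite -[0 in LHS](scale0r 0) snormZ Normc.normc0 mul0r. Qed.

Lemma snormN l (a : A) : snorm l (- a) = snorm l a.
Proof. by rewrite -scaleN1r snormZ normcN Normc.normc1 mul1r. Qed.

Lemma snorm_ge0 l (a : A) : 0 <= snorm l a.
Proof.
have := snormD l a (- a); rewrite subrr snorm0 snormN -mulr2n.
by rewrite pmulrn_lge0.
Qed.

Lemma amulDr (a b c : A) : amul a (b + c) = amul a b + amul a c.
Proof. by rewrite amulC amulDl !(amulC a). Qed.

Lemma amulZr (k : R[i]) (a b : A) : amul a (k *: b) = k *: amul a b.
Proof. by rewrite amulC amulZl (amulC a). Qed.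

Lemma amulBr (a b c : A) : amul a (b - c) = amul a b - amul a c.
Proof. by rewrite amulDr -scaleN1r amulZr scaleN1r. Qed.

End SnormTheory.

Section IdealAlgebra.
Context {R : realType} (A : comLmcAlgType R) (I : ideal A).

Fact ideal_submod : GRing.submod_closed (ideal_mem I).
Proof.
split=> [|k x y]; rewrite !inE; first exact: ideal0.
by move=> Ix Iy; apply: idealD => //; exact: idealZ.
Qed.
HB.instance Definition _ := GRing.isSubmodClosed.Build R[i] A (ideal_mem I)
  ideal_submod.

Record ideal_alg := IdealAlg { ideal_val :> A; _ : ideal_val \in ideal_mem I }.
HB.instance Definition _ := [isSub for ideal_val].
HB.instance Definition _ := [Choice of ideal_alg by <:].
HB.instance Definition _ := [SubChoice_isSubLmodule of ideal_alg by <:].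

Implicit Types x y z : ideal_alg.

Fact ideal_amul_subproof x y : amul (val x) (val y) \in ideal_mem I.
Proof. by rewrite inE; apply: idealM; have := valP y; rewrite inE. Qed.

Definition ideal_mul x y : ideal_alg := IdealAlg (ideal_amul_subproof x y).
Definition ideal_snorm l x : R := snorm l (val x).

Fact ideal_mulA : associative ideal_mul.
Proof. by move=> x y z; apply: val_inj; exact: amulA. Qed.

Fact ideal_mulC : commutative ideal_mul.
Proof. by move=> x y; apply: val_inj; exact: amulC. Qed.

Fact ideal_mulDl x y z : ideal_mul (x + y) z = ideal_mul x z + ideal_mul y z.
Proof. by apply: val_inj; exact: amulDl. Qed.

Fact ideal_mulZl (k : R[i]) x y : ideal_mul (k *: x) y = k *: ideal_mul x y.
Proof. by apply: val_inj; exact: amulZl. Qed.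

Fact ideal_snormD l x y :
  ideal_snorm l (x + y) <= ideal_snorm l x + ideal_snorm l y.
Proof. exact: snormD. Qed.

Fact ideal_snormZ l (k : R[i]) x :
  ideal_snorm l (k *: x) = cabs k * ideal_snorm l x.
Proof. exact: snormZ. Qed.

Fact ideal_snormM l x y :
  ideal_snorm l (ideal_mul x y) <= ideal_snorm l x * ideal_snorm l y.
Proof. exact: snormM. Qed.

Fact ideal_snorm_le l x : ideal_snorm l x <= ideal_snorm l.+1 x.
Proof. exact: snorm_le. Qed.

HB.instance Definition _ := Lmodule_isComLmcAlg.Build R ideal_alg
  ideal_mulA ideal_mulC ideal_mulDl ideal_mulZl
  ideal_snormD ideal_snormZ ideal_snormM ideal_snorm_le.

End IdealAlgebra.

(* The construction below makes sense for any ideal; the quotient is Hausdorff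
   exactly when the ideal is closed. *)
Section QuotientAlgebra.
Context {R : realType} (A : comLmcAlgType R) (I : ideal A).

Definition quot_alg : Type := Quotient.quot (ideal_mem I).
HB.instance Definition _ := GRing.Zmodule.on quot_alg.
HB.instance Definition _ := EqQuotient.on quot_alg.

Implicit Types p q r : quot_alg.

Definition coset (x : A) : quot_alg := \pi x.

Fact cosetP x y : reflect (coset x = coset y) ((x - y) \in ideal_mem I).
Proof. by rewrite Quotient.idealrBE; exact: eqP. Qed.

Fact cosetD x y : coset (x + y) = coset x + coset y.
Proof. by rewrite /coset piE. Qed.

Fact coset_repr q : coset (repr q) = q.
Proof. exact: reprK. Qed.

Definition quot_scale (k : R[i]) q : quot_alg := coset (k *: repr q).
Definition quot_mul p q : quot_alg := coset (amul (repr p) (repr q)).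
Definition quot_snorm l q : R :=
  inf [set snorm l (repr q + y) | y in (I : set A)].

Fact quot_scale_coset k x : quot_scale k (coset x) = coset (k *: x).
Proof.
apply/cosetP; rewrite -scalerBr rpredZ//.
by apply/cosetP; rewrite coset_repr.
Qed.

Fact quot_mul_coset x y : quot_mul (coset x) (coset y) = coset (amul x y).
Proof.
apply/cosetP; rewrite -(subrKA (amul x (repr (coset y)))) rpredD//.
  rewrite -!(amulC (repr (coset y))) -amulBr inE; apply: idealM.
  by have /cosetP := coset_repr (coset x); rewrite inE.
rewrite -amulBr inE; apply: idealM.
by have /cosetP := coset_repr (coset y); rewrite inE.
Qed.

Fact quot_scaleA k m q : quot_scale k (quot_scale m q) = quot_scale (k * m) q.
Proof. by rewrite -[q]coset_repr !quot_scale_coset scalerA. Qed.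

Fact quot_scale1 : left_id 1 quot_scale.
Proof. by move=> q; rewrite -[q]coset_repr quot_scale_coset scale1r. Qed.

Fact quot_scaleDr : right_distributive quot_scale +%R.
Proof.
move=> k p q; rewrite -[p]coset_repr -[q]coset_repr -cosetD !quot_scale_coset.
by rewrite scalerDr cosetD.
Qed.

Fact quot_scaleDl q : {morph quot_scale^~ q : k m / k + m}.
Proof.
by move=> k m; rewrite -[q]coset_repr !quot_scale_coset scalerDl cosetD.
Qed.
HB.instance Definition _ := GRing.Zmodule_isLmodule.Build R[i] quot_alg
  quot_scaleA quot_scale1 quot_scaleDr quot_scaleDl.

Fact cosetZ (k : R[i]) x : coset (k *: x) = k *: coset x.
Proof. by rewrite -quot_scale_coset. Qed.

Definition quot_set l q : set R := [set snorm l x | x in [set x | coset x = q]].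

Fact quot_snormE l q : quot_snorm l q = inf (quot_set l q).
Proof.
congr inf; apply/seteqP; split=> _ [x /= xq <-].
  exists (repr q + x) => //=; rewrite -[RHS]coset_repr.
  by apply/cosetP; rewrite addrAC subrr add0r inE.
exists (x - repr q); last by rewrite addrC subrK.
by have /cosetP : coset x = coset (repr q) by [rewrite coset_repr]; rewrite inE.
Qed.

Fact quot_set_neq0 l q : quot_set l q !=set0.
Proof. by exists (snorm l (repr q)), (repr q) => //=; exact: coset_repr. Qed.

Fact quot_set_lb l q : lbound (quot_set l q) 0.
Proof. by move=> _ [x _ <-]; exact: snorm_ge0. Qed.

Fact quot_snorm_le_snorm l x : quot_snorm l (coset x) <= snorm l x.
Proof.
by rewrite quot_snormE; apply: ge_inf; [exists 0; exact: quot_set_lb|exists x].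
Qed.

Fact quot_snorm_ge0 l q : 0 <= quot_snorm l q.
Proof.
rewrite quot_snormE.
exact: lb_le_inf (quot_set_neq0 l q) (@quot_set_lb l q).
Qed.

Fact le_quot_snormD l q c d : (forall x, coset x = q -> c <= snorm l x + d) ->
  c <= quot_snorm l q + d.
Proof.
move=> h; rewrite -lerBlDr quot_snormE; apply: lb_le_inf (quot_set_neq0 l q) _.
by move=> _ [x /= xq <-]; rewrite lerBlDr h.
Qed.

Fact le_quot_snormM l q c d : 0 <= d ->
  (forall x, coset x = q -> c <= snorm l x * d) -> c <= quot_snorm l q * d.
Proof.
rewrite le_eqVlt => /predU1P[<- h|d0 h].
  by have := h _ (coset_repr q); rewrite !mulr0.
rewrite -ler_pdivrMr// quot_snormE; apply: lb_le_inf (quot_set_neq0 l q) _.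
by move=> _ [x /= xq <-]; rewrite ler_pdivrMr// h.
Qed.

Fact quot_mulA : associative quot_mul.
Proof.
move=> p q r; rewrite -[p]coset_repr -[q]coset_repr -[r]coset_repr.
by rewrite !quot_mul_coset amulA.
Qed.

Fact quot_mulC : commutative quot_mul.
Proof.
by move=> p q; rewrite -[p]coset_repr -[q]coset_repr !quot_mul_coset amulC.
Qed.

Fact quot_mulDl p q r : quot_mul (p + q) r = quot_mul p r + quot_mul q r.
Proof.
rewrite -[p]coset_repr -[q]coset_repr -[r]coset_repr -cosetD !quot_mul_coset.
by rewrite amulDl cosetD.
Qed.

Fact quot_mulZl (k : R[i]) p q : quot_mul (k *: p) q = k *: quot_mul p q.
Proof.
rewrite -[p]coset_repr -[q]coset_repr -cosetZ !quot_mul_coset.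
by rewrite amulZl cosetZ.
Qed.

Fact quot_snormD l p q :
  quot_snorm l (p + q) <= quot_snorm l p + quot_snorm l q.
Proof.
apply: le_quot_snormD => x <-; rewrite [leRHS]addrC.
apply: le_quot_snormD => y <-.
by rewrite -cosetD (le_trans (quot_snorm_le_snorm _ _))// [leRHS]addrC snormD.
Qed.

Fact quot_snormZ_le l (k : R[i]) q :
  quot_snorm l (k *: q) <= cabs k * quot_snorm l q.
Proof.
rewrite mulrC; apply: le_quot_snormM => [|x <-].
  by case: k => ??; exact: sqrtr_ge0.
by rewrite -cosetZ (le_trans (quot_snorm_le_snorm _ _))// snormZ mulrC.
Qed.

Fact quot_snormZ l (k : R[i]) q :
  quot_snorm l (k *: q) = cabs k * quot_snorm l q.
Proof.
apply/eqP; rewrite eq_le quot_snormZ_le/=.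
have [->|k0] := eqVneq k 0; first by rewrite Normc.normc0 mul0r quot_snorm_ge0.
have := quot_snormZ_le l k^-1 (k *: q).
rewrite scalerA mulVf// scale1r => h.
have ck : 0 < cabs k.
  rewrite lt_def; apply/andP; split; last by case: (k) => ??; exact: sqrtr_ge0.
  by apply: contra k0 => /eqP /Normc.eq0_normc ->.
by rewrite -ler_pdivlMl// -Normc.normcV.
Qed.

Fact quot_snormM l p q :
  quot_snorm l (quot_mul p q) <= quot_snorm l p * quot_snorm l q.
Proof.
apply: le_quot_snormM => [|x <-]; [exact: quot_snorm_ge0|rewrite mulrC].
apply: le_quot_snormM => [|y <-]; first exact: snorm_ge0.
rewrite quot_mul_coset (le_trans (quot_snorm_le_snorm _ _))// [leRHS]mulrC.
exact: snormM.
Qed.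

Fact quot_snorm_le l q : quot_snorm l q <= quot_snorm l.+1 q.
Proof.
rewrite -[leRHS]addr0; apply: le_quot_snormD => x <-.
by rewrite addr0 (le_trans (quot_snorm_le_snorm _ _))// snorm_le.
Qed.

HB.instance Definition _ := Lmodule_isComLmcAlg.Build R quot_alg
  quot_mulA quot_mulC quot_mulDl quot_mulZl
  quot_snormD quot_snormZ quot_snormM quot_snorm_le.

Fact coset_mul x y : amul (coset x) (coset y) = coset (amul x y).
Proof. exact: quot_mul_coset. Qed.

Fact snorm_coset l x :
  snorm l (coset x) = inf [set snorm l (x + y) | y in (I : set A)].
Proof.
rewrite [LHS]quot_snormE; congr inf; apply/seteqP; split=> _ [z /= zx <-].
  exists (z - x); last by rewrite addrC subrK.
  by move/cosetP: zx; rewrite inE.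
exists (x + z) => //=; apply/cosetP.
by rewrite addrAC subrr add0r inE.
Qed.

End QuotientAlgebra.

Section BSE.
Context {R : realType} (C : comLmcAlgType R).

Definition topological_dual : set (C -> R[i]^o) :=
  [set f : C -> R[i]^o | linear f /\ continuous f].

(* The product topology [ptws] is that of pointwise convergence on [C]; it
   induces the Gelfand topology on the carrier space below. *)
Definition characters : set {ptws C -> R[i]^o} := [set phi |
  [/\ topological_dual phi,
      forall a b, phi (amul a b) = phi a * phi b & exists a, phi a != 0]].

Definition carrier_space : Type := set_type characters.
HB.instance Definition _ := Topological.on carrier_space.

Definition eval_char (phi : carrier_space) : C -> R[i]^o := set_val phi.
Coercion eval_char : carrier_space >-> Funclass.

Definition seminorm_bounded (M : set C) : Prop :=
  forall l, exists r : R, forall a, M a -> snorm l a <= r.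

(* [sup set0 = 0], so an empty [M] yields the zero function. *)
Definition sup_norm (M : set C) (f : C -> R[i]^o) : R :=
  sup [set cabs (f a) | a in M].

Definition BSE_functions : set (carrier_space -> R[i]^o) :=
  [set sigma : carrier_space -> R[i]^o |
  [/\ continuous sigma,
      exists r : R, forall phi, cabs (sigma phi) <= r &
      exists M : set C, exists beta : R, [/\ seminorm_bounded M, 0 < beta &
        forall n (c : 'I_n -> R[i]) (phi : 'I_n -> carrier_space),
          cabs (\sum_(i < n) c i * sigma (phi i)) <=
          beta * sup_norm M (fun a => \sum_(i < n) c i * phi i a)]]].

Definition multiplier (T : C -> C) : Prop :=
  linear T /\ forall a b, amul a (T b) = T (amul a b).

(* For a multiplier [T] this determines [s], since characters are nonzero. *)
Definition is_hat (T : C -> C) (s : carrier_space -> R[i]^o) : Prop :=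
  continuous s /\ forall (phi : carrier_space) a, phi (T a) = s phi * phi a.

Definition multiplier_hats : set (carrier_space -> R[i]^o) :=
  [set s : carrier_space -> R[i]^o | exists2 T, multiplier T & is_hat T s].

Definition BSE_algebra : Prop := multiplier_hats = BSE_functions.

Definition is_seminorm (p : C -> R) : Prop :=
  (forall a b, p (a + b) <= p a + p b) /\
  (forall (k : R[i]) a, p (k *: a) = cabs k * p a).

(* Precompactness with respect to a seminorm is total boundedness; the library's
   [precompact] means relatively compact. *)
Definition precompact_for (p : C -> R) (S : set C) : Prop :=
  forall e : R, 0 < e -> exists F : seq C,
    forall a, S a -> exists2 b, b \in F & p (a - b) < e.

Definition schwartz : Prop :=
  forall p : C -> R, is_seminorm p -> continuous p ->
  exists q : C -> R, [/\ is_seminorm q, continuous q, forall a, p a <= q a &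
    precompact_for p [set a | q a <= 1]].

End BSE.

Definition discrete_space (T : topologicalType) : Prop :=
  forall U : set T, open U.

Arguments carrier_space {R} C.
Arguments BSE_functions {R} C.
Arguments multiplier_hats {R} C.

(* Main.v *)
(* In a complete algebra whose bounded sets are precompact, every BSE-function is
   the Gelfand transform of an element: a Helly-type argument produces, in a
   fixed bounded set, elements matching [sigma] on any finite set of characters
   up to any error, and an ultrafilter refining these conditions is Cauchy.
   Completeness and precompactness (from the Schwartz property) pass to closed
   ideals and to quotients, which gives (i) and one inclusion of (ii).  Applied to
   the function 1 on the BSE-algebra [A] itself, it gives [e] in [A] on which all
   characters take the value 1; hence the transform of a multiplier [T] of [A/I]
   is that of the element [T (e + I)], bounded because transforms of elements of
   [A] are BSE-functions. *)
From mathcomp Require Import all_boot all_order all_algebra complex.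
From mathcomp Require Import boolp classical_sets functions reals.
From mathcomp Require Import interval_inference topology normedtype.
From mathcomp Require Import ring lra.
Require Import Defs.

Set Implicit Arguments.
Unset Strict Implicit.
Unset Printing Implicit Defensive.

Import Order.TTheory GRing.Theory Num.Theory.
Import numFieldNormedType.Exports.

Local Open Scope classical_set_scope.
Local Open Scope ring_scope.
Local Open Scope complex_scope.

(** * The complex modulus: expansions, phases and neighbourhoods *)

Section Modulus.
Context {R : realType}.
Implicit Types z w : R[i].

Lemma cabs_ge0 z : 0 <= cabs z.
Proof. by case: z => a b; exact: sqrtr_ge0. Qed.

Lemma cabsD z w : cabs (z + w) <= cabs z + cabs w.
Proof. exact: (@le_normcD R). Qed.

Lemma cabs_real (t : R) : 0 <= t -> cabs t%:C = t.
Proof. by move=> t0; rewrite /= expr0n addr0 sqrtr_sqr ger0_norm. Qed.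

Lemma Re_le_cabs z : complex.Re z <= cabs z.
Proof.
case: z => a b /=; rewrite (le_trans (ler_norm _))// -sqrtr_sqr.
by rewrite ler_wsqrtr// lerDl sqr_ge0.
Qed.

Lemma sqr_cabs (a b : R) : cabs (a +i* b) ^+ 2 = a ^+ 2 + b ^+ 2.
Proof. by rewrite /= sqr_sqrtr// addr_ge0// sqr_ge0. Qed.

(** Makes the squared distance along a segment a quadratic polynomial in its parameter [t]. *)
Lemma sqr_cabsBZ z w (t : R) : cabs (z - t%:C * w) ^+ 2 =
  cabs z ^+ 2 - 2 * t * complex.Re (z^* * w) + t ^+ 2 * cabs w ^+ 2.
Proof.
case: z w => a b [c d]; rewrite sqr_cabs; rewrite !sqr_cabs /=; ring.
Qed.

Lemma unit_phase z : exists2 u : R[i], cabs u = 1 & u * z = (cabs z)%:C.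
Proof.
have [->|z0] := eqVneq z 0.
  by exists 1; rewrite ?Normc.normc1// mulr0 Normc.normc0.
have cz : cabs z != 0 by apply: contra z0 => /eqP/Normc.eq0_normc ->.
exists ((cabs z)%:C / z); first by
  rewrite Normc.normcM Normc.normcV cabs_real ?cabs_ge0// divff.
by rewrite divfK.
Qed.

Lemma normcE z : `|z| = (cabs z)%:C. Proof. by []. Qed.

Lemma nbhs_cabs z (U : set R[i]^o) :
  nbhs (z : R[i]^o) U <->
  exists2 e : R, 0 < e & forall w, cabs (z - w) < e -> U w.
Proof.
split.
  move=> /nbhs_normP[e /= e0 eU].
  (* The radius given by the library is an element of [R[i]]; positivity makes it real. *)
  have eE : e = (complex.Re e)%:C by rewrite RRe_real// gtr0_real.
  exists (complex.Re e); first by rewrite -ltcR -eE.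
  by move=> w zw; apply: eU => /=; rewrite normcE eE ltcR.
move=> [e e0 eU]; apply/(nbhs_normP (z : R[i]^o) U); exists e%:C; first by rewrite /= ltcR.
by move=> w /=; rewrite normcE ltcR; exact: eU.
Qed.

End Modulus.

(** * Neighbourhoods given by seminorms, and continuity as domination *)

Section SeminormTopology.
Context {R : realType} {C : comLmcAlgType R}.
Implicit Types (x y : C) (U M : set C).

Lemma snorm_leq l m x : (l <= m)%N -> snorm l x <= snorm m x.
Proof.
by move=> /subnK <-; elim: (m - l)%N => [//|k IH]; rewrite (le_trans IH)// snorm_le.
Qed.

Lemma nbhs_snorm x U : nbhs x U <->
  exists l (e : R), 0 < e /\ forall y, snorm l (x - y) < e -> U y.
Proof.
split.
  move=> /nbhsP[E]; rewrite entourage_snorm => -[l [e [e0 eE]]] EU.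
  by exists l, e; split=> // y /eE xy; apply: EU; apply/xsectionP.
move=> [l [e [e0 eU]]]; apply/nbhsP.
exists [set ab : C * C | snorm l (ab.1 - ab.2) < e].
  by rewrite entourage_snorm; exists l, e; split.
by move=> y /xsectionP; exact: eU.
Qed.

Lemma snorm_seminorm l : is_seminorm (@snorm R C l).
Proof. by split=> [a b|k a]; [exact: snormD|exact: snormZ]. Qed.

Lemma snorm_continuous l : continuous (@snorm R C l : C -> R).
Proof.
move=> x U /nbhs_normP[e /= e0 eU]; apply/nbhs_snorm; exists l, e; split=> // y xy.
apply: eU => /=; rewrite (le_lt_trans _ xy)// ler_norml.
have := snormD l (x - y) y; rewrite subrK => h.
have := snormD l (y - x) x; rewrite subrK -(opprB x y) snormN => h'.
by apply/andP; split; lra.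
Qed.

(** By homogeneity, a seminorm ball on which [g < 1] already forces a global linear bound. *)
Lemma seminorm_dominated (g : C -> R) : is_seminorm g -> 
  nbhs (0 : C) [set a | g a < 1] ->
  exists l, exists2 K : R, 0 <= K & forall a, g a <= K * snorm l a.
Proof.
move=> [gD gZ] /nbhs_snorm[l [e [e0 eg]]].
exists l, (2 / e) => [|a]; first by rewrite divr_ge0// ltW.
have g_scaled (t : R) : 0 < t -> t * snorm l a < e -> t * g a <= 1.
  move=> t0 ta; rewrite -[X in X * _](cabs_real (ltW t0)) -gZ ltW//; apply: eg.
  by rewrite sub0r snormN snormZ cabs_real// ltW.
have [s0|s0] := ltP 0 (snorm l a).
  (* This multiple of [a] has seminorm [e / 2], strictly inside the ball; hence [K = 2 / e]. *)
  have t0 : 0 < e / (2 * snorm l a) by rewrite divr_gt0// mulr_gt0.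
  have -> : 2 / e * snorm l a = (e / (2 * snorm l a))^-1.
    by field; rewrite !gt_eqF.
  rewrite -[leRHS]mulr1 ler_pdivlMl//; apply: g_scaled => //.
  have -> : e / (2 * snorm l a) * snorm l a = e / 2 by field; rewrite gt_eqF.
  by lra.
have s0' : snorm l a = 0 by apply/eqP; rewrite eq_le s0 snorm_ge0.
(* Every multiple of [a] stays in the ball, yet the one by [2 / g a] would have [g]-value 2. *)
rewrite s0' mulr0 leNgt; apply/negP => g0.
have := g_scaled (2 / g a); rewrite divr_gt0// s0' mulr0 => /(_ isT e0).
by rewrite divfK ?gt_eqF//; lra.
Qed.

Lemma dual0 (f : C -> R[i]^o) : linear f -> f 0 = 0.
Proof.
by move=> flin; have := flin (-1) 0 0; rewrite scaler0 addr0 scaleN1r addNr.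
Qed.

Lemma dualD (f : C -> R[i]^o) x y : linear f -> f (x + y) = f x + f y.
Proof. by move=> flin; rewrite -[x]scale1r flin !scale1r. Qed.

Lemma dualZ (f : C -> R[i]^o) k x : linear f -> f (k *: x) = k * f x.
Proof. by move=> flin; rewrite -[k *: x]addr0 flin dual0// addr0. Qed.

Lemma dualB (f : C -> R[i]^o) x y : linear f -> f (x - y) = f x - f y.
Proof. by move=> flin; rewrite dualD// -scaleN1r dualZ// mulN1r. Qed.

Lemma dual_bounded (f : C -> R[i]^o) : topological_dual f ->
  exists l, exists2 K : R, 0 <= K & forall a, cabs (f a) <= K * snorm l a.
Proof.
move=> [flin fcont]; apply: (seminorm_dominated (g := fun a => cabs (f a))).
  split=> [a b|k a]; first by rewrite dualD//; exact: cabsD.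
  by rewrite dualZ// Normc.normcM.
apply: (fcont 0 [set w | cabs w < 1]); apply/nbhs_cabs; exists 1 => // w.
by rewrite dual0// sub0r normcN.
Qed.

End SeminormTopology.

(** * Helly-type approximation in boxes of seminorms *)

Section Helly.
Context {R : realType} {C : comLmcAlgType R}.

(** Bounded sets lie in boxes, which are convex and balanced, so no hulls have to be formed. *)
Definition snorm_box (r : nat -> R) : set C :=
  [set x | forall l, snorm l x <= r l].

Lemma snorm_box_convex (r : nat -> R) (t : R) x y : 0 <= t <= 1 ->
  snorm_box r x -> snorm_box r y -> snorm_box r (x + t%:C *: (y - x)).
Proof.
move=> /andP[t0 t1] xr yr l.
have -> : x + t%:C *: (y - x) = (1 - t)%:C *: x + t%:C *: y.
  by rewrite scalerBr rmorphB rmorph1 scalerBl scale1r addrA addrAC.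
rewrite (le_trans (snormD _ _ _))// !snormZ !cabs_real ?subr_ge0//.
have -> : r l = (1 - t) * r l + t * r l by ring.
by rewrite lerD// ler_wpM2l ?subr_ge0.
Qed.

Lemma dual_bounded_box (f : C -> R[i]^o) r : topological_dual f ->
  exists B, forall x, snorm_box r x -> cabs (f x) <= B.
Proof.
move=> /dual_bounded[l [K K0 fK]]; exists (K * r l) => x xr.
by rewrite (le_trans (fK x))// ler_wpM2l.
Qed.

(** [0 <= B] accounts for an empty [M], where [sup_norm] is 0. *)
Lemma le_sup_norm (M : set C) (g : C -> R[i]^o) (B : R) : 0 <= B ->
  (forall a, M a -> cabs (g a) <= B) -> sup_norm M g <= B.
Proof.
move=> B0 gB; rewrite /sup_norm; have [->|/set0P[a Ma]] := eqVneq M set0.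
  by rewrite image_set0 sup0.
apply: ge_sup; first by exists (cabs (g a)), a.
by move=> _ [b Mb <-]; exact: gB.
Qed.

(* If [M] lies in the box of radii [r], then [beta M] lies in the box [K] of
   radii [beta r].  Were [s] at distance [sqrt d > 0] from the image of [K] under
   [f], moving a near-minimiser [y] a fraction [t] towards any [z] in [K] would
   gain at most [t d]; so the functional [g] with coefficients
   [(s i - f i y)^*] would violate the hypothesis. *)
Lemma helly_approx (M : set C) (beta : R) n (s : 'I_n -> R[i])
    (f : 'I_n -> C -> R[i]^o) (r : nat -> R) (e : R) :
  0 < beta -> (forall l, 0 <= r l) -> M `<=` snorm_box r ->
  (forall i, topological_dual (f i)) ->
  (forall c : 'I_n -> R[i], cabs (\sum_(i < n) c i * s i) <=
    beta * sup_norm M (fun a => \sum_(i < n) c i * f i a)) ->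
  0 < e -> exists2 x, snorm_box (fun l => beta * r l) x &
    forall i, cabs (s i - f i x) < e.
Proof.
move=> b0 r0 Mr fd hs e0; set K := snorm_box _.
have flin i : linear (f i) by have [] := fd i.
pose E x : R := \sum_(i < n) cabs (s i - f i x) ^+ 2.
have E0 x : 0 <= E x by apply: sumr_ge0 => i _; exact: sqr_ge0.
have K0 : K 0 by move=> l; rewrite snorm0 mulr_ge0// ltW.
have EK : has_inf (E @` K).
  by split; [exists (E 0), 0|exists 0 => _ [x _ <-]].
pose d := inf (E @` K).
have dE x : K x -> d <= E x by move=> Kx; apply: ge_inf; [exact: EK.2|exists x].
have [de|ed] := ltP d (e ^+ 2).
  have [_ [x Kx <-] xe] := inf_lt EK.1 de.
  exists x => // i; rewrite -(ltr_pXn2r (n := 2)) ?nnegrE ?cabs_ge0 ?ltW//.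
  apply: le_lt_trans xe; rewrite /E (bigD1 i)//= lerDl.
  by apply: sumr_ge0 => j _; exact: sqr_ge0.
exfalso; have d0 : 0 < d by rewrite (lt_le_trans _ ed)// exprn_gt0.
have /choice[B fB] : forall i, exists B, forall x, K x -> cabs (f i x) <= B.
  by move=> i; exact: dual_bounded_box.
(* [D] bounds the coefficient of [t ^+ 2] in [E] along any segment inside [K]. *)
pose D : R := \sum_(i < n) (B i + B i) ^+ 2.
have D0 : 0 <= D by apply: sumr_ge0 => i _; exact: sqr_ge0.
(* Chosen with [t * D < d], so that the excess [(d + t * D) / 2] in [gB] falls short of the gap [d]
   in [gs]. *)
pose t := d / (D + d).
have Dd : 0 < D + d by rewrite ltr_wpDl.
have t0 : 0 < t by rewrite divr_gt0.
have t1 : t <= 1 by rewrite ler_pdivrMr// mul1r lerDr.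
have tD : t * D < d.
  by rewrite /t mulrAC ltr_pdivrMr// ltr_pM2l// ltrDl.
have [_ [y Ky <-] yd] := inf_adherent (mulr_gt0 t0 d0) EK.
rewrite -/d in yd.
pose c i := (s i - f i y)^*.
pose g a : R[i]^o := \sum_(i < n) c i * f i a.
have gB z : K z -> complex.Re (g z) <= complex.Re (g y) + (d + t * D) / 2.
  move=> Kz.
  have : d <= E (y + t%:C *: (z - y)).
    by apply/dE/snorm_box_convex => //; rewrite t1 ltW.
  have -> : E (y + t%:C *: (z - y)) = E y - 2 * t * complex.Re (g z - g y)
      + t ^+ 2 * \sum_(i < n) cabs (f i (z - y)) ^+ 2.
    have -> : g z - g y = \sum_(i < n) c i * f i (z - y).
      by rewrite -sumrB; apply: eq_bigr => i _; rewrite dualB// mulrBr.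
    rewrite (raddf_sum (@complex.Re R)) !mulr_sumr -sumrB -big_split/=.
    apply: eq_bigr => i _.
    by rewrite dualD// dualZ// opprD addrA sqr_cabsBZ.
  have : \sum_(i < n) cabs (f i (z - y)) ^+ 2 <= D.
    apply: ler_sum => i _; rewrite ler_pXn2r ?nnegrE ?cabs_ge0//; last first.
      by rewrite addr_ge0// (le_trans (cabs_ge0 _) (fB i 0 K0)).
    rewrite dualB// (le_trans (cabsD _ _))// normcN.
    by rewrite lerD// fB.
  rewrite raddfB/=; set S := (X in X <= _) => SD.
  have : t ^+ 2 * S <= t ^+ 2 * D by rewrite ler_wpM2l// sqr_ge0.
  set u := complex.Re _; set v := complex.Re _ => h1 h2.
  rewrite -subr_ge0 -(pmulr_rge0 _ t0).
  by move: h1 h2 yd; rewrite -/S; clearbody d S D t; lra.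
(* Term by term the gap is [c i * (s i - f i y) = cabs (s i - f i y) ^+ 2], which sums to [E y]. *)
have gs : d + complex.Re (g y) <= complex.Re (\sum_(i < n) c i * s i).
  apply: le_trans (lerD (dE y Ky) (lexx _)) _.
  rewrite /g !(raddf_sum (@complex.Re R)) -big_split/= le_eqVlt; apply/orP; left.
  apply/eqP; apply: eq_bigr => i _; rewrite /c.
  case: (s i) (f i y) => a b [a' b']; rewrite sqr_cabs/=; ring.
have : complex.Re (\sum_(i < n) c i * s i) <= complex.Re (g y) + (d + t * D) / 2.
  apply: le_trans (Re_le_cabs _) _; apply: le_trans (hs c) _.
  rewrite -ler_pdivlMl//; apply: le_sup_norm => [|a Ma].
    apply: mulr_ge0; first by rewrite invr_ge0 ltW.
    by have := gB 0 K0; rewrite [g 0]big1// => i _; rewrite dual0// mulr0.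
  (* Turning [a] by a phase makes [g] real and nonnegative there; the multiple by [beta] then lies
     in [K], so [gB] applies. *)
  rewrite ler_pdivlMl//; have [u u1 ua] := unit_phase (g a).
  have -> : beta * cabs (g a) = complex.Re (g ((beta%:C * u) *: a)).
    have -> : g ((beta%:C * u) *: a) = beta%:C * (u * g a).
      rewrite mulrA /g mulr_sumr; apply: eq_bigr => i _.
      by rewrite dualZ// mulrCA.
    by rewrite ua /= mulr0 subr0.
  apply: gB => l; rewrite snormZ Normc.normcM u1 mulr1 cabs_real ?(ltW b0)//.
  by rewrite ler_pM2l//; exact: Mr.
by lra.
Qed.

End Helly.

(** * BSE-functions as evaluations, by completeness and finite colourings *)

Section CompleteColorable.
Context {R : realType}.

(* Precompactness of the unit ball of [snorm m] for [snorm l]; colourings avoid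
   mentioning centres, so that the property restricts to subspaces. *)
Definition finitely_colorable (C : comLmcAlgType R) : Prop :=
  forall l, exists m, forall e : R, 0 < e -> exists n, exists f : C -> 'I_n,
    forall a b, snorm m a <= 1 -> snorm m b <= 1 -> f a = f b ->
      snorm l (a - b) < e.

Definition cauchy_complete (E : uniformType) : Prop :=
  forall F : set_system E, ProperFilter F -> cauchy F -> exists x : E, F --> x.

Lemma cauchy_snormP (C : comLmcAlgType R) (F : set_system C) : Filter F ->
  cauchy F <-> forall l (e : R), 0 < e -> exists2 U, F U &
    forall a b, U a -> U b -> snorm l (a - b) < e.
Proof.
move=> FF; split.
  move=> Fc l e e0.
  have /Fc[[U V]/= [FU FV] UVe] :
      entourage [set ab : C * C | snorm l (ab.1 - ab.2) < e].
    by rewrite entourage_snorm; exists l, e; split.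
  exists (U `&` V); first exact: filterI.
  by move=> a b [Ua _] [_ Vb]; exact: (UVe (a, b)).
move=> h E; rewrite entourage_snorm => -[l [e [e0 eE]]].
have [U FU Ue] := h l e e0.
by exists (U, U) => // -[a b] [/= Ua Ub]; apply/eE/Ue.
Qed.

Lemma box_colorable (C : comLmcAlgType R) (r : nat -> R) l (e : R) :
  finitely_colorable C -> (forall l, 0 <= r l) -> 0 < e ->
  exists n, exists f : C -> 'I_n, forall a b,
    snorm_box r a -> snorm_box r b -> f a = f b -> snorm l (a - b) < e.
Proof.
(* Scaling by [k] moves the box into the unit ball of [snorm m]; the [+ 1] keeps the divisor
   positive. *)
move=> /(_ l)[m colm] r0 e0; pose k := (r m + 1)^-1.
have r1 : 0 < r m + 1 by rewrite ltr_wpDl.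
have k0 : 0 < k by rewrite invr_gt0.
have [n [f fe]] := colm (k * e) (mulr_gt0 k0 e0).
exists n, (fun a => f (k%:C *: a)) => a b ar br fab.
have scaled (c : C) : snorm_box r c -> snorm m (k%:C *: c) <= 1.
  move=> cr; rewrite snormZ cabs_real ?(ltW k0)// ler_pdivrMl// mulr1.
  by rewrite (le_trans (cr m))// lerDl.
have := fe _ _ (scaled a ar) (scaled b br) fab.
by rewrite -scalerBr snormZ cabs_real ?(ltW k0)// ltr_pM2l.
Qed.

(** Otherwise [G] would contain the complements of the finitely many colour classes, whose
    intersection is empty. *)
Lemma ultra_color (T : Type) (G : set_system T) n (f : T -> 'I_n) :
  UltraFilter G -> exists i, G [set x | f x = i].
Proof.
move=> GU; apply: contrapT => /forallNP h.
have : G [set x | forall i, f x <> i].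
  apply: filter_forall => i.
  by have [/h|] := in_ultra_setVsetC [set x | f x = i] GU.
by move=> /filter_ex[x /(_ (f x))].
Qed.

Lemma carrier_dual (C : comLmcAlgType R) (phi : carrier_space C) :
  topological_dual phi.
Proof. by have [h _ _] := set_valP phi; exact: h. Qed.

Lemma carrierM (C : comLmcAlgType R) (phi : carrier_space C) a b :
  phi (amul a b) = phi a * phi b.
Proof. by have [_ h _] := set_valP phi; exact: h. Qed.

Lemma carrier_neq0 (C : comLmcAlgType R) (phi : carrier_space C) :
  exists a, phi a != 0.
Proof. by have [_ _ h] := set_valP phi; exact: h. Qed.

Lemma BSE_function_evaluation (C : comLmcAlgType R)
    (sigma : carrier_space C -> R[i]^o) :
  finitely_colorable C -> cauchy_complete C -> BSE_functions C sigma ->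
  exists x, forall phi : carrier_space C, sigma phi = phi x.
Proof.
move=> colC compC [_ _ [M [beta [Mb b0 hM]]]].
have /choice[r0 Mr0] : forall l, exists r : R, forall a, M a -> snorm l a <= r.
  by move=> l; exact: Mb.
(* For an empty [M] the bound [r0 l] may be negative. *)
pose r l := Num.max 0 (r0 l).
have rge0 l : 0 <= r l by rewrite le_max lexx.
have Mr : M `<=` snorm_box r.
  by move=> a Ma l; rewrite le_max Mr0// orbT.
pose K : set C := snorm_box (fun l => beta * r l).
pose D := [set se : seq (carrier_space C) * R | 0 < se.2].
pose B (se : seq (carrier_space C) * R) := [set x | K x /\
  forall phi : carrier_space C, phi \in se.1 -> cabs (sigma phi - phi x) < se.2].
have FF : ProperFilter (filter_from D B).
  apply: filter_from_proper.
    apply: filter_from_filter; first by exists ([::], 1); exact: ltr01.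
    move=> [s e] [s' e'] /= e0 e0'.
    exists (s ++ s', Num.min e e'); first by rewrite /D /= lt_min e0.
    by move=> x [Kx h]; split; split=> // phi /= phis;
      have := h phi; rewrite /= mem_cat phis ?orbT => /(_ isT);
      rewrite lt_min => /andP[].
  move=> [s e] e0.
  have [x Kx xe] := helly_approx (s := fun i => sigma (tnth (in_tuple s) i))
    (f := fun i => tnth (in_tuple s) i) b0 rge0 Mr
    (fun i => carrier_dual _) (fun c => hM _ c _) e0.
  by exists x; split=> // phi /= /(tnthP (in_tuple s))[i ->].
have [G [GU FG]] := ultraFilterLemma FF.
have GB s (e : R) : 0 < e -> G (B (s, e)) by move=> e0; apply: FG; exists (s, e).
have GK : G K by apply: filterS (GB [::] 1 ltr01) => x [].
have /compC[x Gx] : cauchy G.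
  apply/cauchy_snormP => l e e0.
  have [l'|n [f fe]] := box_colorable (r := fun l => beta * r l) l colC _ e0.
    by rewrite mulr_ge0// ltW.
  (* The ultrafilter picks one colour, and points of [K] of that colour are [e]-close for
     [snorm l]. *)
  have [i Gi] := ultra_color f GU.
  exists (K `&` [set x | f x = i]); first exact: filterI.
  by move=> a b [Ka /= ai] [Kb /= bi]; apply: fe => //; rewrite ai.
exists x => phi; apply/eqP; rewrite -subr_eq0; apply: contraT => nz.
pose e := cabs (sigma phi - phi x).
have e0 : 0 < e / 2.
  rewrite divr_gt0// lt_neqAle cabs_ge0 andbT eq_sym.
  by apply: contra nz => /eqP/Normc.eq0_normc ->.
have Gphi : G [set y | cabs (phi x - phi y) < e / 2].
  apply: Gx; have [_ /(_ x) phic] := carrier_dual phi.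
  by apply: (phic [set w | cabs (phi x - w) < e / 2]); apply/nbhs_cabs; exists (e / 2).
(* Some [phi y] is within [e / 2] of both [sigma phi] and [phi x], which are [e] apart. *)
have [y [[_ /(_ phi)]]] := @filter_ex _ G _ _ (filterI (GB [:: phi] _ e0) Gphi).
rewrite /= mem_head => /(_ isT) h1 h2; suff : e < e by rewrite ltxx.
rewrite {1}/e -(subrKA (phi y)) (le_lt_trans (cabsD _ _))//.
by rewrite (splitr e) ltrD// -opprB normcN.
Qed.

End CompleteColorable.

(** * Finite colourings from the Schwartz property; passage to ideals and quotients *)

Section Inheritance.
Context {R : realType}.

(** Continuity bounds the Schwartz seminorm [q] by some [K * snorm m]; a point is coloured by the
    first centre close to its multiple by [1 / (K + 1)]. *)
Lemma schwartz_colorable (C : comLmcAlgType R) :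
  schwartz C -> finitely_colorable C.
Proof.
move=> schC l.
have [q [[qD qZ] qc pq qpre]] := schC _ (snorm_seminorm l) (@snorm_continuous R C l).
have q0 : q 0 = 0 by rewrite -(scale0r 0) qZ Normc.normc0 mul0r.
have [|m [K K0 qm]] := seminorm_dominated (conj qD qZ).
  apply: (qc 0 [set t : R | t < 1]); rewrite q0; apply/nbhs_normP.
  exists 1 => [|t /=]; first exact: ltr01.
  by rewrite sub0r normrN => /ltr_normlW.
exists m => e e0; pose k := (K + 1)^-1.
have K1 : 0 < K + 1 by rewrite ltr_wpDl.
have k0 : 0 < k by rewrite invr_gt0.
have ke0 : 0 < k * (e / 2) by rewrite mulr_gt0// divr_gt0.
have [F hF] := qpre _ ke0.
pose near (a b : C) := snorm l (k%:C *: a - b) < k * (e / 2).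
(* [find] returns [size F] when no centre is near, hence the extra colour. *)
exists (size F).+1, (fun a => inord (find (near a) F)).
have found (a : C) : snorm m a <= 1 -> near a (nth 0 F (find (near a) F)).
  move=> a1; apply: (nth_find 0); have [|b bF ab] := hF (k%:C *: a).
    rewrite /= qZ cabs_real ?(ltW k0)// ler_pdivrMl// mulr1 (le_trans (qm a))//.
    by rewrite (@le_trans _ _ (K * 1))// ?ler_wpM2l// mulr1 lerDl.
  by apply/hasP; exists b.
move=> a b /found na /found nb.
move=> /(congr1 val); rewrite /= !inordK ?ltnS ?find_size// => fab.
rewrite fab in na; set c := nth _ _ _ in na nb.
suff : snorm l (k%:C *: (a - b)) < k * e.
  by rewrite snormZ cabs_real ?(ltW k0)// ltr_pM2l.
rewrite scalerBr -(subrKA c) (splitr e) mulrDr (le_lt_trans (snormD _ _ _))//.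
by rewrite ltrD// -opprB snormN.
Qed.

Lemma ideal_colorable (C : comLmcAlgType R) (I : ideal C) :
  finitely_colorable C -> finitely_colorable (ideal_alg I).
Proof.
move=> colC l; have [m colm] := colC l; exists m => e e0.
have [n [f fe]] := colm e e0.
by exists n, (fun x => f (val x)) => a b; exact: fe.
Qed.

(** Closedness keeps the limit found in [C] inside [I], where the seminorms are restrictions. *)
Lemma ideal_complete (C : comLmcAlgType R) (I : ideal C) :
  closed (I : set C) -> cauchy_complete C -> cauchy_complete (ideal_alg I).
Proof.
move=> Icl compC F FF /cauchy_snormP Fc.
have [|x Fx] := compC (fmap (val : ideal_alg I -> C) F) _.
  apply/cauchy_snormP => l e e0; have [U FU Ue] := Fc l e e0.
  exists (val @` U); first by apply: (filterS (F := F)) FU; exact: preimage_image.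
  by move=> _ _ [a Ua <-] [b Ub <-]; exact: Ue.
have Ix : x \in ideal_mem I.
  rewrite inE; apply: Icl => U /Fx FU.
  have [a Ua] := @filter_ex _ F _ _ FU.
  by exists (val a); split=> //; have := valP a; rewrite inE.
exists (IdealAlg Ix) => U /nbhs_snorm[l [e [e0 eU]]].
have : nbhs x [set y | snorm l (x - y) < e].
  by apply/nbhs_snorm; exists l, e; split.
by move=> /Fx; apply: (filterS (F := F)) => a /= xa; exact: eU.
Qed.

(** The infimum need not be attained, so it is a strict bound that lifts. *)
Lemma quot_snorm_lift (C : comLmcAlgType R) (I : ideal C) l (q : quot_alg I) (c : R) :
  snorm l q < c -> exists2 x, coset I x = q & snorm l x < c.
Proof.
rewrite [snorm l q]quot_snormE => /(inf_lt (quot_set_neq0 l q))[_ [x xq <-] xc].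
by exists x.
Qed.

Lemma cosetB (C : comLmcAlgType R) (I : ideal C) x y :
  coset I (x - y) = coset I x - coset I y.
Proof. by apply: (addIr (coset I y)); rewrite -cosetD !subrK. Qed.

(** A coset takes the colour of half a representative: the unit ball is lifted into radius 2, and
    [e / 2] makes up for the halving. *)
Lemma quot_colorable (C : comLmcAlgType R) (I : ideal C) :
  finitely_colorable C -> finitely_colorable (quot_alg I).
Proof.
move=> colC l; have [m colm] := colC l; exists m => e e0.
have [n [f fe]] := colm (e / 2) (divr_gt0 e0 (ltr0Sn _ 1)).
have /choice[L hL] : forall q : quot_alg I, exists x,
    coset I x = q /\ (snorm m q <= 1 -> snorm m x <= 2).
  move=> q; have [q1|q1] := leP (snorm m q) 1.
    have [|x xq x2] := @quot_snorm_lift _ _ m q 2; last by exists x; split=> // _; exact: ltW.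
    by rewrite (le_lt_trans q1)// ltr1n.
  by exists (repr q); split; [exact: coset_repr|].
have half0 : 0 <= 2^-1 :> R by rewrite invr_ge0.
exists n, (fun q => f ((2^-1)%:C *: L q)) => p q p1 q1 fpq.
have := fe _ _ _ _ fpq; rewrite -scalerBr !snormZ cabs_real//.
have [Lp /(_ p1) Lp2] := hL p; have [Lq /(_ q1) Lq2] := hL q.
rewrite !ler_pdivrMl// mulr1 => /(_ Lp2 Lq2); rewrite mulrC ltr_pM2r ?invr_gt0// => h.
have -> : p - q = coset I (L p - L q) by rewrite cosetB Lp Lq.
by apply: le_lt_trans h; exact: quot_snorm_le_snorm.
Qed.

(* The increments of a fast Cauchy sequence of cosets lift to a geometrically
   summable sequence. *)
Lemma quot_complete (C : comLmcAlgType R) (I : ideal C) :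
  cauchy_complete C -> cauchy_complete (quot_alg I).
Proof.
move=> compC F FF /cauchy_snormP Fc.
pose h n : R := 1 / 2 ^+ n.
have h0 n : 0 < h n by rewrite divr_gt0// exprn_gt0.
have hS n : h n.+1 = h n / 2 by rewrite /h exprS invfM; ring.
have small (e : R) : 0 < e -> exists n, forall m, (n <= m)%N -> h m < e.
  move=> e0; have [n _ nP] := near_infty_natSinv_expn_lt (PosNum e0).
  by exists n => m nm; exact: nP.
have /choice[U hU] : forall l, exists U, F U /\
    forall a b, U a -> U b -> snorm l (a - b) < h l.
  by move=> l; have [U FU Ue] := Fc l _ (h0 l); exists U.
(* Taking [q l] in all [U k] with [k <= l] puts both [q l] and [q l.+1] in [U l]. *)
have /choice[q qU] : forall l, exists q, forall k : 'I_l.+1, U k q.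
  move=> l; apply: (@filter_ex _ F); apply: filter_forall => k.
  exact: (hU k).1.
have /choice[d hd] : forall l, exists d : C,
    coset I d = q l.+1 - q l /\ snorm l d < h l.
  move=> l; have [|d dq dl] := @quot_snorm_lift _ I l (q l.+1 - q l) (h l).
    apply: (hU l).2; last exact: (qU l ord_max).
    by have lt : (l < l.+2)%N := leqnSn l.+1; exact: (qU l.+1 (Ordinal lt)).
  by exists d.
pose x n := repr (q 0%N) + \sum_(k < n) d k.
have xS n : x n.+1 = x n + d n by rewrite /x big_ord_recr/= addrA.
have xq n : coset I (x n) = q n.
  elim: n => [|n IH]; first by rewrite /x big_ord0 addr0 coset_repr.
  by rewrite xS cosetD IH (hd n).1 addrC subrK.
(* The right side is the sum of [h k] over [l <= k < l + n], telescoped by [hS]. *)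
have xd l n : snorm l (x (l + n)%N - x l) <= 2 * h l - 2 * h (l + n)%N.
  elim: n => [|n IH]; first by rewrite addn0 !subrr snorm0.
  have -> : x (l + n.+1)%N - x l = (x (l + n)%N - x l) + d (l + n)%N.
    by rewrite addnS xS addrAC.
  have := snorm_leq (d (l + n)%N) (leq_addr n l).
  have := (hd (l + n)%N).2; have := snormD l (x (l + n)%N - x l) (d (l + n)%N).
  rewrite addnS hS; lra.
have xl l m : (l <= m)%N -> snorm l (x m - x l) <= 2 * h l.
  move=> /subnKC <-; apply: le_trans (xd _ _) _.
  by have := h0 (l + (m - l))%N; lra.
have [|y xy] := compC (x @ \oo) _.
  apply/cauchy_snormP => l e e0.
  have [n nP] := small (e / 4) (divr_gt0 e0 (ltr0Sn _ 3)).
  pose N := maxn l n; exists (x @` [set m | (N <= m)%N]).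
    by exists N => // m /= Nm; exists m.
  move=> _ _ [m Nm <-] [m' Nm' <-]; rewrite -(subrKA (x N)).
  apply: le_lt_trans (snorm_leq _ (leq_maxl l n)) _.
  apply: le_lt_trans (snormD _ _ _) _.
  have := nP N (leq_maxr l n); have := xl N m Nm; have := xl N m' Nm'.
  rewrite -(opprB (x N)) snormN; lra.
exists (coset I y) => V /nbhs_snorm[l [e [e0 eV]]].
have [n nP] := small (e / 2) (divr_gt0 e0 (ltr0Sn _ 1)).
have [N _ NP] : \forall m \near \oo, snorm l (y - x m) < e / 2.
  apply: (xy [set z | snorm l (y - z) < e / 2]); apply/nbhs_snorm.
  by exists l, (e / 2); split; first exact: divr_gt0.
pose m := maxn l (maxn n N).
have lm : (l <= m)%N by rewrite leq_maxl.
have nm : (n <= m)%N by rewrite !leq_max leqnn orbT.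
have Nm : (N <= m)%N by rewrite !leq_max leqnn !orbT.
(* [U m] is small for [snorm m] and contains [q m], the coset of [x m], which is close to [y]. *)
apply: (filterS (F := F)) (hU m).1 => z Uz; apply: eV.
rewrite -(subrKA (q m)) (splitr e) (le_lt_trans (snormD _ _ _))// ltrD//.
  rewrite -xq -cosetB; apply: le_lt_trans (NP m Nm).
  exact: quot_snorm_le_snorm.
apply: le_lt_trans (snorm_leq _ lm) _; apply: lt_trans (nP m nm).
by apply: (hU m).2 => //; exact: (qU m ord_max).
Qed.

End Inheritance.

(** * Evaluations as multiplier transforms and BSE-functions; pullback of characters *)

Section Evaluations.
Context {R : realType}.

Lemma evaluation_continuous (C : comLmcAlgType R) (a : C) :
  continuous (fun phi : carrier_space C => phi a : R[i]^o).
Proof.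
move=> phi; apply: (@continuous_comp _ {ptws C -> R[i]^o} _
  (set_val : carrier_space C -> {ptws C -> R[i]^o}) (fun f => f a)).
  exact: initial_continuous.
exact: (@proj_continuous C (fun=> R[i]^o) a).
Qed.

Lemma amul_multiplier (C : comLmcAlgType R) (a : C) : multiplier (amul a).
Proof.
split=> [k u v|b c]; first by rewrite amulDr amulZr.
by rewrite !amulA (amulC b).
Qed.

Lemma evaluation_multiplier_hat (C : comLmcAlgType R) (a : C) :
  multiplier_hats C (fun phi => phi a).
Proof.
exists (amul a); first exact: amul_multiplier.
by split=> [|phi b]; [exact: evaluation_continuous|exact: carrierM].
Qed.

Lemma BSE_sub_multiplier_hats (C : comLmcAlgType R) :
  finitely_colorable C -> cauchy_complete C ->
  BSE_functions C `<=` multiplier_hats C.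
Proof.
move=> colC compC sigma BSEs.
have [x sx] := BSE_function_evaluation colC compC BSEs.
by have -> : sigma = fun phi => phi x; [exact/funext|exact: evaluation_multiplier_hat].
Qed.

(** The identity multiplier has transform 1, which is thus a BSE-function and so an evaluation. *)
Lemma BSE_algebra_unit (C : comLmcAlgType R) :
  BSE_algebra C -> finitely_colorable C -> cauchy_complete C ->
  exists e : C, forall chi : carrier_space C, chi e = 1.
Proof.
move=> BSE_C colC compC.
have [|e he] := @BSE_function_evaluation _ _ (fun=> 1) colC compC.
  rewrite -BSE_C; exists id; first by split.
  by split=> [|phi a]; [exact: cst_continuous|rewrite mul1r].
by exists e => chi; rewrite -he.
Qed.

Lemma coset_continuous (C : comLmcAlgType R) (I : ideal C) : continuous (coset I).
Proof.
move=> x U /nbhs_snorm[l [e [e0 eU]]]; apply/nbhs_snorm; exists l, e; split=> // y xy.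
by apply: eU; rewrite -cosetB (le_lt_trans _ xy)//; exact: quot_snorm_le_snorm.
Qed.

(** Lets facts about all characters of [C] be used on the quotient. *)
Lemma carrier_pullback (C : comLmcAlgType R) (I : ideal C)
    (phi : carrier_space (quot_alg I)) :
  exists chi : carrier_space C, forall a, chi a = phi (coset I a).
Proof.
have [philin phicont] := carrier_dual phi.
have phi_char : characters (fun a : C => phi (coset I a)).
  split; first split.
  - by move=> k a b; rewrite cosetD cosetZ philin.
  - by move=> a; apply: continuous_comp; [exact: coset_continuous|exact: phicont].
  - by move=> a b; rewrite -coset_mul carrierM.
  - by have [q q0] := carrier_neq0 phi; exists (repr q); rewrite coset_repr.
by exists (exist (fun f => f \in @characters R C) _ (mem_set phi_char)).
Qed.

Lemma evaluation_BSE (C : comLmcAlgType R) (a : C) (r : R) :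
  (forall phi : carrier_space C, cabs (phi a) <= r) ->
  BSE_functions C (fun phi => phi a).
Proof.
move=> ar; split; [exact: evaluation_continuous|by exists r|].
(* For [M = [set a]] and [beta = 1] the BSE inequality is an equality. *)
exists [set a], 1; split=> // [l|n c phi]; first by exists (snorm l a) => _ ->.
by rewrite mul1r /sup_norm image_set1 sup1.
Qed.

End Evaluations.

Theorem theorem3p2 (R : realType) (A : comFrechetAlgType R) (I : ideal A) :
  BSE_algebra A -> schwartz A -> discrete_space (carrier_space A) ->
  closed (I : set A) -> essential I ->
  (BSE_functions (ideal_alg I) `<=` multiplier_hats (ideal_alg I)) /\
  multiplier_hats (quot_alg I) = BSE_functions (quot_alg I).
Proof.
move=> BSE_A /schwartz_colorable colA _ Icl _.
have compA : cauchy_complete A := @frechet_complete R A.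
split.
  apply: BSE_sub_multiplier_hats; first exact: ideal_colorable.
  exact: ideal_complete.
apply/seteqP; split; last first.
  apply: BSE_sub_multiplier_hats; first exact: quot_colorable.
  exact: quot_complete.
have [e chi_e] := BSE_algebra_unit BSE_A colA compA.
move=> s [T _ [_ sT]].
(* [phi] sends [T (coset I e)] to [s phi * phi (coset I e)], and the last factor is [chi e = 1]. *)
have -> : s = fun phi => phi (T (coset I e)).
  apply/funext => phi; have [chi chiE] := carrier_pullback phi.
  by rewrite sT -chiE chi_e mulr1.
(* The bound [r] comes from [A], where evaluation at a representative is a multiplier transform,
   hence a BSE-function. *)
have /= := evaluation_multiplier_hat (repr (T (coset I e))).
rewrite BSE_A => -[_ [r hr] _]; apply: (evaluation_BSE (r := r)) => phi.
have [chi chiE] := carrier_pullback phi.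
by rewrite -[X in phi X]coset_repr -chiE.
Qed.
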